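(* Let $Y$ be a random variable satisfying the moment conditions stated in the context, let $0<q<1$, $x\in[0,1]$, and let $n,r$ be integers with $0\le r\le n$. Then $$B_{r,n}^{Y}(x,q)=\sum_{l=0}^{n-r}\sum_{k=0}^{l}\binom{n}{r}\binom{n-r}{l}\left\{{l\atop k}\right\}_{Y}\bigl(-[x]_{q^{-1}}\bigr)_k\,[x]_q^{r}\,\mathrm{E}\bigl[Y^{n-r-l}\bigr].$$
   Context: Moment conditions on the real random variable $Y$: there is $\rho>0$ such that $\mathrm{E}[|Y|^n]<\infty$ for all $n\ge 0$ and $\lim_{n\to\infty}|v|^n\mathrm{E}[|Y|^n]/n!=0$ for $|v|<\rho$. Hence $\mathrm{E}[e^{vY}]=\sum_{n\ge0}\mathrm{E}[Y^n]v^n/n!$ is a power series in $v$ with constant term $1$, and for real $c$ the power $(\mathrm{E}[e^{vY}])^c$ denotes the power series with constant term $1$. $q$-numbers: $[x]_q=\frac{q^x-1}{q-1}$ and $[x]_{q^{-1}}=\frac{q^{-x}-1}{q^{-1}-1}$; one has $[1-x]_q=1-[x]_{q^{-1}}$. Probabilistic $q$-Bernstein polynomials $B_{r,n}^Y(x,q)$: $\sum_{n=r}^{\infty}B_{r,n}^{Y}(x,q)\frac{v^n}{n!}=\frac{(v[x]_q)^r}{r!}\left(\mathrm{E}[e^{vY}]\right)^{[1-x]_q}$. Probabilistic Stirling numbers of the second kind: $\sum_{n=m}^{\infty}\left\{{n\atop m}\right\}_Y\frac{v^n}{n!}=\frac{(\mathrm{E}[e^{vY}]-1)^m}{m!}$.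 $(z)_k=z(z-1)\cdots(z-k+1)$, $(z)_0=1$, is the falling factorial. *)

(* Defs.v *)
From HB Require Import structures.
From mathcomp Require Export all_boot all_order all_algebra.
From mathcomp Require Export all_classical all_reals all_analysis.

Set Implicit Arguments.
Unset Strict Implicit.
Unset Printing Implicit Defensive.

Import Order.TTheory GRing.Theory Num.Theory.
Import numFieldNormedType.Exports.

Local Open Scope classical_set_scope.
Local Open Scope ring_scope.

(* A formal power series f_0 + f_1 v + f_2 v^2 + ... over R is the sequence
   of its coefficients f : nat -> R. *)
Section FormalPowerSeries.
Context {R : realType}.
Implicit Types (f g a : nat -> R) (c : R).

Definition fps_one : nat -> R := fun n => (n == 0%N)%:R.

Definition fps_X : nat -> R := fun n => (n == 1%N)%:R.

Definition fps_scale c f : nat -> R := fun n => c * f n.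

Definition fps_sub f g : nat -> R := fun n => f n - g n.

Definition fps_mul f g : nat -> R :=
  fun n => \sum_(i < n.+1) f i * g (n - i)%N.

Definition fps_expn f k : nat -> R := iter k (fps_mul f) fps_one.

(* sum_k a_k g^k.  Meaningful when g has constant term 0: then g^k does not
   contribute to the coefficient of v^n for k > n. *)
Definition fps_comp a g : nat -> R :=
  fun n => \sum_(k < n.+1) a k * fps_expn g k n.

Definition fps_exp : nat -> R := fun k => (k`!%:R)^-1.

(* log (1 + v) = sum_(k >= 1) (-1)^(k-1) v^k / k. *)
Definition fps_log1p : nat -> R :=
  fun k => if k is j.+1 then (- 1) ^+ j / j.+1%:R else 0.

(* f^c = exp (c log f), for f with constant term 1; it is again a series with
   constant term 1. *)
Definition fps_powr f c : nat -> R :=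
  fps_comp fps_exp (fps_scale c (fps_comp fps_log1p (fps_sub f fps_one))).

(* The b_n such that f = sum_n b_n v^n / n!. *)
Definition egf_coef f : nat -> R := fun n => n`!%:R * f n.

(* The power series expansion at 0 of a real function. *)
Definition fps_of_fun (F : R -> R) : nat -> R :=
  fun n => derive1n n F 0 / n`!%:R.

End FormalPowerSeries.

(* [x]_q; the number [x]_(q^-1) is qnum q^-1 x. *)
Definition qnum (R : realType) (q x : R) : R := (q `^ x - 1) / (q - 1).

Definition falling (R : realType) (z : R) (k : nat) : R :=
  \prod_(i < k) (z - i%:R).

Section Probabilistic.
Context d (T : measurableType d) (R : realType) (P : probability T R).
Implicit Type Y : {RV P >-> R}.

Definition moment_conditions Y : Prop :=
  exists rho : R, [/\ 0 < rho,
    forall k : nat, ('E_P[fun w => (`|Y w| ^+ k)%R] < +oo)%E &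
    forall v : R, `|v| < rho ->
      (fun k : nat =>
         `|v| ^+ k * fine 'E_P[fun w => (`|Y w| ^+ k)%R] / k`!%:R)
        @ \oo --> (0 : R)].

Definition moment Y (k : nat) : R := fine 'E_P[fun w => (Y w ^+ k)%R].

(* The power series of v |-> E[e^(vY)].  Under the moment conditions this
   expectation is finite and analytic for v near 0. *)
Definition mgf_series Y : nat -> R := fps_of_fun (fun v => fine ('M_P Y v)).

(* Generating function (v [x]_q)^r / r! * (E[e^(vY)])^([1-x]_q). *)
Definition prob_qbernstein Y (r n : nat) (x q : R) : R :=
  egf_coef
    (fps_mul
       (fps_scale (r`!%:R)^-1 (fps_expn (fps_scale (qnum q x) fps_X) r))
       (fps_powr (mgf_series Y) (qnum q (1 - x)))) n.

(* {n, m}_Y, with generating function (E[e^(vY)] - 1)^m / m!. *)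
Definition prob_stirling2 Y (n m : nat) : R :=
  egf_coef
    (fps_scale (m`!%:R)^-1 (fps_expn (fps_sub (mgf_series Y) fps_one) m)) n.

End Probabilistic.

(* Main.v *)
Require Import Defs.
From mathcomp Require Import measurable_realfun ring lra.

(* With f the series of E[e^(vY)], a = [x]_(q^-1) and [1 - x]_q = 1 - a, we have
   f^(1 - a) = f f^(- a), and f^(- a) = sum_k (- a)_k (f - 1)^k / k! by the
   binomial series; the coefficients of f are the E[Y^k] / k! and those of
   (f - 1)^k / k! are the Stirling numbers.  The moment conditions give
   dominated convergence of the partial sums of e^(vY), so E[e^(vY)] is
   sum_k E[Y^k] v^k / k! near 0 and its derivatives at 0 are the moments.
   Formal series are compared with polynomials modulo X^N, so that the ring
   laws and associativity of composition come from {poly R}. *)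

Set Implicit Arguments.
Unset Strict Implicit.
Unset Printing Implicit Defensive.

Import Order.TTheory GRing.Theory Num.Theory.
Import numFieldNormedType.Exports.

Local Open Scope ring_scope.

(** * Real power series: discs of convergence and termwise differentiation *)

Section PowerSeries.
Context {R : realType}.
Implicit Types (a : nat -> R) (rho z : R).

(** Here [rho] is only a lower bound for the radius of convergence. *)
Definition pseries_radius a rho : Prop :=
  forall z, `|z| < rho -> cvgn (pseries a z).

Lemma cvg_norm_bounded (u : nat -> R) :
  cvgn u -> exists C : R, forall k, `|u k| <= C.
Proof.
move=> /cvg_seq_bounded[K [_ KP]]; exists (`|K| + 1) => k; apply: KP => //.
by rewrite (le_lt_trans (ler_norm _))// ltrDl.
Qed.

Lemma exists_norm_between rho z : `|z| < rho ->
  exists2 s : R, `|z| < `|s| & `|s| < rho.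
Proof.
move=> zrho; have z0 := normr_ge0 z.
have s0 : 0 <= (`|z| + rho) / 2 by lra.
by exists ((`|z| + rho) / 2); rewrite (ger0_norm s0); lra.
Qed.

(** Abel's lemma: bounded terms at some [s] with |z| < |s| < [rho] dominate the series at [z] by a
    geometric one of ratio |z/s| < 1. *)
Lemma pseries_radius_bounded a rho :
  (forall z, `|z| < rho -> exists C : R, forall k, `|a k * z ^+ k| <= C) ->
  pseries_radius a rho.
Proof.
move=> aB z /exists_norm_between[s zs /aB[C aC]].
have s0 : 0 < `|s| by apply: le_lt_trans zs.
apply: normed_cvg; rewrite /normed_series_of /=.
apply: (@series_le_cvg _ _ (geometric C `|z / s|)).
- by move=> n.
- move=> n; rewrite /geometric /= mulr_ge0 ?exprn_ge0//.
  by apply: le_trans (aC 0%N).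
- move=> n; rewrite /geometric /=.
  have -> : a n * z ^+ n = a n * s ^+ n * (z / s) ^+ n.
    rewrite -mulrA -exprMn mulrCA divff ?mulr1//.
    by rewrite -normr_gt0.
  by rewrite normrM normrX ler_wpM2r ?exprn_ge0.
- apply: is_cvg_geometric_series.
  by rewrite normr_id normrM normfV ltr_pdivrMr ?mul1r.
Qed.

(** Each of the n + 1 terms of 1 + t + ... + t^n is at least t^n. For t < 1 this bounds (n + 1) t^n
    by 1 / (1 - t), uniformly in n. *)
Lemma natr_mul_exprn_le (t : R) n : 0 <= t <= 1 ->
  n.+1%:R * t ^+ n * (1 - t) <= 1 - t ^+ n.+1.
Proof.
move=> /andP[t0 t1]; elim: n => [|n IHn]; first by rewrite !mul1r.
rewrite -[n.+2%:R]natr1 [t ^+ n.+2]exprS.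
have -> : (n.+1%:R + 1) * t ^+ n.+1 * (1 - t) =
    t * (n.+1%:R * t ^+ n * (1 - t)) + t ^+ n.+1 * (1 - t).
  by rewrite exprS; ring.
have := ler_wpM2l t0 IHn; have : t ^+ n.+1 <= 1 by rewrite exprn_ile1.
by nra.
Qed.

(** The factor k + 1 created by differentiation is absorbed by moving from [z] to a larger [s]: with
    t = |z/s|, the term is a bounded term at [s] times (k + 1) t^k / |s|. *)
Lemma pseries_radius_diffs a rho :
  pseries_radius a rho -> pseries_radius (pseries_diffs a) rho.
Proof.
move=> aR; apply: pseries_radius_bounded => z /exists_norm_between[s zs srho].
have s0 : 0 < `|s| by apply: le_lt_trans zs.
have [C aC] : exists C : R, forall k, `|a k * s ^+ k| <= C.
  by apply: cvg_norm_bounded; apply/cvgP/cvg_series_cvg_0/aR.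
pose t : R := `|z / s|.
have t0 : 0 <= t by exact: normr_ge0.
have t1 : t < 1 by rewrite /t normrM normfV ltr_pdivrMr ?mul1r.
have t10 : 0 < 1 - t by rewrite subr_gt0.
exists (C / `|s| / (1 - t)) => k; rewrite ler_pdivlMr//.
have -> : `|pseries_diffs a k * z ^+ k| =
    `|a k.+1 * s ^+ k.+1| / `|s| * (k.+1%:R * t ^+ k).
  rewrite /t /pseries_diffs -[k.+1%:R in RHS]normr_nat -normrX -normfV -!normrM.
  congr (`|_|); rewrite expr_div_n exprSr.
  have sn0 : s != 0 by rewrite -normr_gt0.
  by field; rewrite expf_neq0.
have tk : k.+1%:R * t ^+ k * (1 - t) <= 1.
  apply: le_trans (natr_mul_exprn_le _ _) _; first by rewrite t0 ltW.
  by rewrite lerBlDr lerDl exprn_ge0.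
rewrite -[leRHS]mulr1 -(mulrA (_ / _)) ler_pM// ?divr_ge0//.
- by rewrite mulr_ge0 ?(ltW t10)// mulr_ge0 ?exprn_ge0.
- by rewrite ler_wpM2r ?invr_ge0.
Qed.

Lemma limn_pseries0 a : limn (pseries a 0) = a 0%N.
Proof.
apply: lim_near_cst => //; near=> n.
rewrite /pseries /series /= -[n]prednK; last by near: n; exists 1%N.
rewrite big_nat_recl// expr0 mulr1 big1 ?addr0// => i _.
by rewrite exprS mul0r mulr0.
Unshelve. all: by end_near. Qed.

Lemma iter_pseries_diffs a n k :
  iter n (@pseries_diffs R) a k * k`!%:R = (n + k)`!%:R * a (n + k)%N.
Proof.
elim: n k => [|n IHn] k; first by rewrite mulrC.
by rewrite iterS /pseries_diffs addSnnS -IHn factS natrM; ring.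
Qed.

Lemma derive1n_pseries a rho (F : R -> R) n : 0 < rho ->
  pseries_radius a rho ->
  (forall z, `|z| < rho -> F z = limn (pseries a z)) ->
  derive1n n F 0 = n`!%:R * a n.
Proof.
move=> rho0 aR FE.
have aRn m : pseries_radius (iter m (@pseries_diffs R) a) rho.
  by elim: m => //= m; exact: pseries_radius_diffs.
(* Proved on the whole disc and not only at 0, because differentiating at [z] requires the formula
   of order [m] in a neighbourhood of [z]. *)
have FnE m z : `|z| < rho ->
    derive1n m F z = limn (pseries (iter m (@pseries_diffs R) a) z).
  elim: m z => [|m IHm] z zrho; first exact: FE.
  rewrite derive1nS derive1E.
  rewrite (@near_eq_derive _ _ _ _
    (fun y => limn (pseries (iter m (@pseries_diffs R) a) y))).
    (* [pseries_snd_diffs] asks that the series and its first two formal derivatives converge at a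
       point [s] farther from 0 than [z]. *)
    have [s zs srho] := exists_norm_between zrho.
    by have [] := pseries_snd_diffs (aRn m s srho) (aRn m.+1 s srho)
      (aRn m.+2 s srho) zs.
  near=> y; apply: IHm.
  rewrite -(subrK z y) (le_lt_trans (ler_normD _ _))// -ltrBrDr.
  rewrite distrC; near: y.
  by apply: (@nbhsx_ballx _ _ z (rho - `|z|)); rewrite subr_gt0.
rewrite FnE ?normr0// limn_pseries0.
by have := iter_pseries_diffs a n 0; rewrite addn0 fact0 mulr1.
Unshelve. all: by end_near. Qed.

End PowerSeries.

(** * Moments of [Y] and the expansion of E[e^(vY)] near 0 *)

Section MomentGeneratingFunction.
Context d (T : measurableType d) (R : realType) (P : probability T R).
Variables (Y : {RV P >-> R}) (rho : R).
Hypothesis Y_moments :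
  forall k : nat, ('E_P[fun w => (`|Y w| ^+ k)%R] < +oo)%E.
Hypothesis Y_cvg0 : forall v : R, `|v| < rho ->
  ((fun k : nat =>
     `|v| ^+ k * fine 'E_P[fun w => (`|Y w| ^+ k)%R] / k`!%:R)
      @ \oo --> (0 : R))%classic.

Let absmoment k : R := fine 'E_P[fun w => (`|Y w| ^+ k)%R].

Let measurable_powY k : measurable_fun setT (fun w => Y w ^+ k).
Proof. exact: measurable_funX. Qed.

Let measurable_absY k : measurable_fun setT (fun w => `|Y w| ^+ k).
Proof. by apply: measurable_funX; exact: measurableT_comp. Qed.

Let integral_absY k :
  (\int[P]_w (`|Y w| ^+ k)%:E = (absmoment k)%:E)%E.
Proof.
have Yk : ('E_P[fun w => (`|Y w| ^+ k)%R] = \int[P]_w (`|Y w| ^+ k)%:E)%E.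
  by rewrite unlock.
rewrite /absmoment fineK Yk// ge0_fin_numE -?Yk//.
by apply: expectation_ge0 => w; rewrite exprn_ge0.
Qed.

Let integrable_powY k : P.-integrable setT (EFin \o (fun w => Y w ^+ k)).
Proof.
apply/integrableP; split; first exact/measurable_EFinP.
under eq_integral do rewrite /= normrX.
by rewrite integral_absY ltry.
Qed.

(** The moment condition says that the terms tend to 0; they are therefore bounded, which is enough
    for Abel's lemma. *)
Let absmoment_radius : pseries_radius (fun k => absmoment k / k`!%:R) rho.
Proof.
apply: pseries_radius_bounded => z /Y_cvg0 z0.
have [C CP] := cvg_norm_bounded (cvgP _ z0).
exists C => k; apply: le_trans (CP k).
by rewrite !normrM !normrX normr_id mulrC [leLHS]mulrA.
Qed.

Let integral_powY k : (\int[P]_w (Y w ^+ k)%:E = (moment Y k)%:E)%E.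
Proof.
have /fineK <- := integrable_fin_num measurableT (integrable_powY k).
by rewrite /moment unlock.
Qed.

Let moment_le k : `|moment Y k| <= absmoment k.
Proof.
rewrite -lee_fin -integral_absY -abse_EFin -integral_powY.
have := le_abse_integral P measurableT
  (measurable_int _ (integrable_powY k)).
by under [leRHS]eq_integral do rewrite /= normrX.
Qed.

Lemma moment_radius : pseries_radius (fun k => moment Y k / k`!%:R) rho.
Proof.
apply: pseries_radius_bounded => z /exists_norm_between[s zs srho].
have [C CP] :=
  cvg_norm_bounded (cvgP _ (cvg_series_cvg_0 (absmoment_radius srho))).
exists C => k; apply: le_trans (CP k).
rewrite !normrM !normrX ler_pM//.
  by rewrite ler_wpM2r// (le_trans (moment_le k))// ler_norm.
by apply: lerXn2r; rewrite ?nnegrE ?normr_ge0 ?ltW.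
Qed.

(* The partial sums of [e^(vY)] are dominated by [sum_k |vY|^k / k!]. *)
Lemma mgfE v : `|v| < rho ->
  fine ('M_P Y v) = limn (pseries (fun k => moment Y k / k`!%:R) v).
Proof.
move=> vrho.
pose f_ n w : \bar R := (series (exp_coeff (Y w * v)) n)%:E.
pose h k w : \bar R := (`|Y w * v| ^+ k / k`!%:R)%:E.
pose g w : \bar R := (\sum_(k <oo) h k w)%E.
have h0 k w : (0 <= h k w)%E.
  by rewrite lee_fin mulr_ge0 ?invr_ge0// exprn_ge0.
have mh k : measurable_fun setT (h k).
  apply/measurable_EFinP/measurable_funM => //.
  apply: measurable_funX; apply: measurableT_comp => //.
  exact: measurable_funM.
have mg : measurable_fun setT g by apply: ge0_emeasurable_sum.
have inth k : (\int[P]_w h k w = (absmoment k / k`!%:R * `|v| ^+ k)%:E)%E.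
  rewrite mulrAC -mulrA mulrC EFinM -integral_absY -ge0_integralZl_EFin//.
  - apply: eq_integral => w _; rewrite /h -EFinM normrM exprMn; congr EFin.
    ring.
  - exact/measurable_EFinP.
(* All terms are nonnegative, so sum and integral commute; the integral of [g] is the series of
   absolute moments at |v|, which is finite. *)
have ig : P.-integrable setT g.
  apply/integrableP; split => //.
  under eq_integral do rewrite gee0_abs ?nneseries_ge0//.
  rewrite integral_nneseries//.
  under eq_eseriesr do rewrite inth.
  have cv : cvgn (pseries (fun k => absmoment k / k`!%:R) `|v|).
    by apply: absmoment_radius; rewrite normr_id.
  have -> : (\sum_(k <oo) (absmoment k / k`!%:R * `|v| ^+ k)%:E =
     (limn (pseries (fun k => absmoment k / k`!%:R) `|v|))%:E)%E.
    rewrite -EFin_lim//; congr (limn _); apply/funext => n /=.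
    by rewrite /pseries /series /= sumEFin.
  exact: ltry.
have mf n : measurable_fun setT (f_ n).
  apply/measurable_EFinP; rewrite /series/=.
  apply: measurable_sum => k; apply: measurable_funM => //.
  by apply: measurable_funX; exact: measurable_funM.
have mexp : measurable_fun setT (fun w => (expR (Y w * v))%:E).
  apply/measurable_EFinP; apply: measurableT_comp => //.
  exact: measurable_funM.
have fexp : {ae P, forall w, setT w ->
    (f_ ^~ w @ \oo --> (expR (Y w * v))%:E)%classic}.
  apply: aeW => w _; apply: cvg_EFin; first exact: nearW.
  exact: is_cvg_series_exp_coeff.
have fg : {ae P, forall w n, setT w -> (`|f_ n w| <= g w)%E}.
  apply: aeW => w n _; apply: (le_trans _ (nneseries_lim_ge n _)) => //.
  rewrite /f_ /h sumEFin lee_fin /series /= (le_trans (ler_norm_sum _ _ _))//.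
  by apply: ler_sum => k _; rewrite /exp_coeff /= normrM normrX normfV normr_nat.
have intf n : (\int[P]_w f_ n w =
    (pseries (fun k => moment Y k / k`!%:R) v n)%:E)%E.
  rewrite /f_ /series /=.
  under eq_integral do rewrite -sumEFin.
  rewrite integral_sum//; last first.
    move=> k.
    have := integrableZl measurableT (v ^+ k / k`!%:R) (integrable_powY k).
    apply: eq_integrable => // w _; rewrite /exp_coeff /= -EFinM exprMn.
    by congr EFin; ring.
  rewrite /pseries /series /= -sumEFin; apply: eq_bigr => k _.
  rewrite mulrAC -mulrA mulrC EFinM -integral_powY.
  rewrite -integralZl//; last exact: integrable_powY.
  apply: eq_integral => w _; rewrite /exp_coeff /= -EFinM exprMn.
  by congr EFin; ring.
have -> : ('M_P Y v = \int[P]_w (expR (Y w * v))%:E)%E.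
  by rewrite /mmt_gen_fun unlock.
have [_ _] := @dominated_convergence _ _ _ P setT measurableT f_
  (fun w => (expR (Y w * v))%:E) g mf mexp fexp ig fg.
(* The integrals of the dominated partial sums are the partial sums of the moment series, so their
   limit is its sum. *)
under [X in (X @ _)%classic]funext do rewrite /= intf.
move=> /cvg_lim <-//; rewrite -/(EFin \o _) EFin_lim//.
exact: moment_radius.
Qed.

End MomentGeneratingFunction.

(** * Formal power series modulo X^N, and the binomial series *)

Section TruncatedSeries.
Context {R : realType}.
Implicit Types (a f g : nat -> R) (p q A G : {poly R}) (c : R) (N : nat).

(** Coefficients of [p] from degree [N] on are left free, so products and compositions of
    polynomials need no truncation. *)
Definition agree N f p : Prop := forall i, (i < N)%N -> f i = p`_i.

Lemma agree_poly N f : agree N f (\poly_(i < N) f i).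
Proof. by move=> i iN; rewrite coef_poly iN. Qed.

Lemma agree_trans N f g p : agree N f p -> agree N g p ->
  forall i, (i < N)%N -> f i = g i.
Proof. by move=> fp gp i iN; rewrite fp// gp. Qed.

Lemma agree_one N : agree N fps_one 1.
Proof. by move=> i _; rewrite coef1. Qed.

Lemma agree_X N : agree N fps_X 'X.
Proof. by move=> i _; rewrite coefX. Qed.

Lemma agree_scale N c f p : agree N f p -> agree N (fps_scale c f) (c *: p).
Proof. by move=> fp i iN; rewrite coefZ -fp. Qed.

Lemma agree_sub N f g p q : agree N f p -> agree N g q ->
  agree N (fps_sub f g) (p - q).
Proof. by move=> fp gq i iN; rewrite coefB -fp// -gq. Qed.

Lemma agree_mul N f g p q : agree N f p -> agree N g q ->
  agree N (fps_mul f g) (p * q).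
Proof.
move=> fp gq i iN; rewrite coefM; apply: eq_bigr => j _.
rewrite -fp -?gq//; first exact: leq_ltn_trans (leq_subr _ _) iN.
by apply: leq_ltn_trans iN; rewrite -ltnS.
Qed.

Lemma agree_expn N f p k : agree N f p -> agree N (fps_expn f k) (p ^+ k).
Proof.
move=> fp; elim: k => [|k IHk]; first exact: agree_one.
by rewrite exprS; exact: agree_mul.
Qed.

(** A zero constant term makes X divide [G], hence X^k divides G^k. *)
Lemma coef_exp_eq0 G k n : G`_0 = 0 -> (n < k)%N -> (G ^+ k)`_n = 0.
Proof.
move=> G0 nk.
have /factor_theorem[H ->] : root G 0 by rewrite /root horner_coef0 G0.
by rewrite subr0 exprMn coefMXn nk.
Qed.

Lemma agree_comp N a g A G : agree N a A -> agree N g G -> G`_0 = 0 ->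
  agree N (fps_comp a g) (A \Po G).
Proof.
move=> aA gG G0 n nN; rewrite coef_comp_poly /fps_comp.
pose F k := A`_k * (G ^+ k)`_n.
have trunc M : (n < M)%N -> \sum_(k < M) F k = \sum_(k < n.+1) F k.
  move=> nM; rewrite (big_ord_widen _ F nM) [RHS]big_mkcond /=.
  apply: eq_bigr => k _; case: ltnP => // nk.
  by rewrite /F (coef_exp_eq0 G0 nk) mulr0.
transitivity (\sum_(k < n.+1) F k).
  apply: eq_bigr => k _; rewrite /F -(agree_expn k gG nN) -aA//.
  by apply: leq_ltn_trans nN; rewrite -ltnS.
(* One sum stops at [n], the other at the size of [A]; both are extended to the larger bound, where
   the extra terms vanish by divisibility by X^k or because [A] has no such coefficient. *)
rewrite -(trunc (maxn n.+1 (size A))) ?leq_maxl//.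
rewrite (big_ord_widen _ F (leq_maxr n.+1 (size A))) [RHS]big_mkcond /=.
apply: eq_bigr => k _; case: ltnP => // Ak.
by rewrite /F nth_default ?mul0r.
Qed.

(** The generalized binomial coefficients, that is, the series (1 + v)^c. *)
Definition fps_binom c : nat -> R := fun k => falling c k / k`!%:R.

Lemma fallingS c k : falling c k.+1 = falling c k * (c - k%:R).
Proof. by rewrite /falling big_ord_recr. Qed.

Lemma fallingSl c k : falling (c + 1) k.+1 = (c + 1) * falling c k.
Proof.
rewrite /falling big_ord_recl subr0; congr (_ * _); apply: eq_bigr => i _.
by rewrite /= -natr1; ring.
Qed.

(* [p = exp (c log (1 + X))] is determined by [p(0) = 1] and
   [(1 + X) p' = c p]. *)
Lemma agree_powr1p N c :
  agree N (fps_binom c)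
    ((\poly_(k < N) fps_exp k) \Po (c *: \poly_(k < N) fps_log1p k)).
Proof.
case: N => [//|N].
set E := \poly_(k < _) fps_exp k; set L := \poly_(k < _) fps_log1p k.
set p := E \Po _.
have L0 : L`_0 = 0 by rewrite coef_poly.
have cL0 : (c *: L)`_0 = 0 by rewrite coefZ L0 mulr0.
have p0 : p`_0 = 1.
  have := @agree_comp N.+1 fps_exp _ E _ (@agree_poly _ _) (fun i _ => erefl)
    cL0 0%N isT.
  rewrite -/p => <-.
  by rewrite /fps_comp big_ord1 /fps_exp fact0 invr1 mul1r.
(* exp' = exp; truncation at N + 1 leaves this valid only below degree [N], as a derivative loses
   one order. *)
have dE : agree N (fun k => p`_k) (E^`() \Po (c *: L)).
  have := @agree_comp N (fun k => E^`()`_k) _ _ _ (fun i _ => erefl)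
    (fun i _ => erefl) cL0.
  move=> h1 i iN; rewrite -h1//.
  have -> : p`_i = fps_comp (fun k => E`_k) (fun i => (c *: L)`_i) i.
    by rewrite (@agree_comp N.+1 _ _ E (c *: L))// ltnW.
  apply: eq_bigr => k _; congr (_ * _).
  have kN : (k < N)%N by apply: leq_ltn_trans iN; rewrite -ltnS.
  rewrite coef_deriv !coef_poly !ltnS kN ltnW// /fps_exp factS natrM invfM.
  by rewrite -[RHS]mulr_natl mulVKf// pnatr_eq0.
(* The derivative of log (1 + X) is the alternating geometric series, so consecutive coefficients
   cancel in the product. *)
have dL : agree N fps_one ((1 + 'X) * L^`()).
  move=> i iN; rewrite mulrDl mul1r coefD coefXM !coef_deriv !coef_poly.
  rewrite ltnS iN /fps_one; case: i iN => [|i] iN /=.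
    by rewrite expr0 divr1 addr0.
  rewrite ltnS (ltnW iN) /fps_log1p /=.
  rewrite -[X in X + _]mulr_natr -[X in _ + X]mulr_natr !divfK ?pnatr_eq0//.
  by rewrite exprS mulN1r addNr.
have ode : agree N (fun k => c * p`_k) ((1 + 'X) * p^`()).
  have -> : (1 + 'X) * p^`() =
    c *: ((E^`() \Po (c *: L)) * ((1 + 'X) * L^`())).
    by rewrite /p deriv_comp derivZ -!scalerAr mulrCA.
  move=> i iN; rewrite -(agree_scale c (agree_mul dE dL) iN).
  rewrite /fps_scale; congr (_ * _).
  rewrite (@agree_mul i.+1 _ _ p 1) ?mulr1//; exact: agree_one.
(* In degree k the equation reads (k + 1) p_(k+1) + k p_k = c p_k, which is the recurrence of the
   binomial coefficients. *)
elim=> [|k IHk] kN; first by rewrite /fps_binom /falling big_ord0 p0 fact0 divr1.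
have := ode k kN; rewrite mulrDl mul1r coefD coefXM !coef_deriv.
have -> : (if k == 0%N then 0 else p`_k.-1.+1 *+ k.-1.+1) = k%:R * p`_k.
  by case: (k) => [|j] /=; rewrite ?mul0r// mulr_natl.
rewrite -IHk 1?ltnW// => /esym/(canRL (addrK _)).
rewrite -[LHS]mulr_natr => /(canRL (mulfK _)) ->; last by rewrite pnatr_eq0.
rewrite /fps_binom fallingS factS natrM invfM; ring.
Qed.

(** By associativity of composition, exp (c log f) is exp (c log (1 + X)) evaluated at X = f - 1. *)
Lemma fps_powrE f c n : f 0%N = 1 ->
  fps_powr f c n = fps_comp (fps_binom c) (fps_sub f fps_one) n.
Proof.
move=> f0; have F := @agree_poly n.+1 f; set p := \poly_(i < _) _ in F.
have fp := agree_sub F (@agree_one _).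
have p0 : (p - 1)`_0 = 0 by rewrite coefB coef1 coef_poly f0 subrr.
have H := agree_comp (@agree_powr1p n.+1 c) fp p0.
apply: (agree_trans _ H) => //; rewrite -comp_polyA comp_polyZ.
apply: agree_comp; first exact: agree_poly.
  by apply/agree_scale/agree_comp => //; exact: agree_poly.
have := @agree_comp n.+1 _ _ _ _ (@agree_poly n.+1 fps_log1p) fp p0 0%N isT.
by rewrite coefZ => <-; rewrite /fps_comp big_ord1 mul0r mulr0.
Qed.

(** Pascal's rule, in the form (1 + X)^(c + 1) = (1 + X) (1 + X)^c. *)
Lemma agree_binomD1 N c :
  agree N (fps_binom (c + 1)) ((1 + 'X) * \poly_(k < N) fps_binom c k).
Proof.
move=> i iN; rewrite mulrDl mul1r coefD coefXM !coef_poly iN.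
case: i iN => [|i] iN /=; first by rewrite addr0 /fps_binom /falling !big_ord0.
rewrite (ltnW iN) /fps_binom fallingSl fallingS factS natrM invfM -natr1.
by field; rewrite ?natr1 ?pnatr_eq0//= -?lt0n ?fact_gt0.
Qed.

(** Substituting X = f - 1 in Pascal's rule turns the factor 1 + X into [f]; this factor later
    supplies the moments. *)
Lemma fps_powrD1 f c n : f 0%N = 1 ->
  fps_powr f (c + 1) n =
  fps_mul (fps_comp (fps_binom c) (fps_sub f fps_one)) f n.
Proof.
move=> f0; rewrite fps_powrE//.
have F := @agree_poly n.+1 f; set p := \poly_(i < _) _ in F.
have fp := agree_sub F (@agree_one _).
have p0 : (p - 1)`_0 = 0 by rewrite coefB coef1 coef_poly f0 subrr.
have H := agree_comp (@agree_binomD1 n.+1 c) fp p0.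
apply: (agree_trans H) => //; rewrite comp_polyM comp_polyD comp_polyX.
rewrite comp_polyC addrC subrK mulrC; apply: agree_mul => //.
by apply: agree_comp => //; exact: agree_poly.
Qed.

End TruncatedSeries.

(** * Comparison of coefficients in the generating functions *)

Lemma mgf_seriesE d (T : measurableType d) (R : realType)
    (P : probability T R) (Y : {RV P >-> R}) k :
  moment_conditions Y -> mgf_series Y k = moment Y k / k`!%:R.
Proof.
move=> [rho [rho0 Ym Y0]]; rewrite /mgf_series /fps_of_fun.
rewrite (derive1n_pseries _ rho0 (moment_radius Ym Y0) (mgfE Ym Y0)).
by rewrite mulrC mulKf// pnatr_eq0 -lt0n fact_gt0.
Qed.

Lemma qnum1B (R : realType) (q x : R) : 0 < q < 1 ->
  qnum q (1 - x) = - qnum q^-1 x + 1.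
Proof.
move=> /andP[q0 q1]; rewrite /qnum.
have -> : q^-1 `^ x = (q `^ x)^-1.
  by rewrite -powR_inv1 ?ltW// -powRrM mulN1r powRN.
rewrite powRB ?(gt_eqF q0) ?implybT// powRr1 ?ltW//.
have qx0 : q `^ x != 0 by rewrite gt_eqF ?powR_gt0.
by field; rewrite qx0 (gt_eqF q0) mulN1r !subr_eq0 (gt_eqF q1) (lt_eqF q1).
Qed.

Theorem theorem2p2 (d : measure_display) (T : measurableType d)
    (R : realType) (P : probability T R) (Y : {RV P >-> R})
    (q x : R) (n r : nat)
    (hY : moment_conditions Y)
    (hq : 0 < q < 1) (hx : 0 <= x <= 1) (hrn : (r <= n)%N) :
  prob_qbernstein Y r n x q =
  \sum_(l < (n - r).+1) \sum_(k < l.+1)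
     'C(n, r)%:R * 'C(n - r, l)%:R * prob_stirling2 Y l k
     * falling (- qnum q^-1 x) k * qnum q x ^+ r * moment Y (n - r - l).
Proof.
set a := - qnum q^-1 x; set t := qnum q x; set m := (n - r)%N.
have Mk k : mgf_series Y k = moment Y k / k`!%:R by exact: mgf_seriesE.
have M0 : mgf_series Y 0 = 1.
  rewrite Mk fact0 divr1 /moment (_ : (fun _ => _) = cst 1).
    by rewrite expectation_cst.
  by apply/funext => w; rewrite expr0.
rewrite /prob_qbernstein /egf_coef qnum1B// -/a -/t.
have F := @agree_poly R n.+1 (fps_powr (mgf_series Y) (a + 1)).
have H := agree_scale (r`!%:R)^-1
  (agree_expn r (agree_scale t (@agree_X R n.+1))).
rewrite (agree_mul H F)//.
(* The factor (t X)^r / r! shifts the index: what remains is the coefficient of degree n - r of the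
   power with exponent a + 1. *)
rewrite exprZn -!scalerAl !coefZ coefXnM ltnNge hrn /=.
rewrite coef_poly ltnS leq_subr fps_powrD1// /fps_mul -/m !mulr_sumr.
apply: eq_bigr => l _; rewrite /fps_comp mulr_suml !mulr_sumr.
apply: eq_bigr => k _.
have lm : (l <= m)%N by rewrite -ltnS.
rewrite Mk /prob_stirling2 /egf_coef /fps_scale /fps_binom.
(* Of these factorials, l! belongs to the Stirling number, while (m - l)! and r! cancel the
   denominators of the moment and of the prefactor. *)
have <- : 'C(n, r)%:R * 'C(m, l)%:R * l`!%:R * (m - l)`!%:R * r`!%:R =
    n`!%:R :> R.
  by rewrite -!natrM -(bin_fact hrn) -/m -(bin_fact lm); congr (_%:R); ring.
by field; rewrite !pnatr_eq0 -!lt0n !fact_gt0.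
Qed.
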